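(* Let $n\ge 4$ be an integer and let $K(n,2)$ be the Kneser graph whose vertices are the $2$-element subsets of $[n]=\{1,\ldots,n\}$, two vertices being adjacent if and only if they are disjoint. Then \[ \mathrm{gp}(K(n,2)) = \begin{cases} 6, & 4\le n\le 6,\\ n-1, & n\ge 7. \end{cases} \]
   Context: Graphs are finite, undirected and simple. For a graph $G$, $d_G$ is the shortest-path distance; a $u,v$-geodesic is a $u,v$-path of length $d_G(u,v)$ (vertices in different connected components are joined by no geodesic). A set $S\subseteq V(G)$ is a general position set of $G$ if no vertex of $S$ lies on a geodesic between two other vertices of $S$; that is, for no three pairwise different $u,v,w\in S$ lying in one connected component does $d_G(u,v)=d_G(u,w)+d_G(w,v)$ hold. The general position number $\mathrm{gp}(G)$ is the maximum cardinality of a general position set of $G$. *)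

(* Defs.v *)
From mathcomp Require Import all_boot.

Set Implicit Arguments.
Unset Strict Implicit.
Unset Printing Implicit Defensive.

Record sgraph := SGraph {
  vertex :> finType;
  adj : rel vertex;
  adj_sym : symmetric adj;
  adj_irrefl : irreflexive adj }.

Section GeneralPosition.
Variable G : sgraph.
Implicit Types u v w : G.

(* As in [path], the initial vertex u is not listed in p, so that the length
   (number of edges) of the path is [size p]. *)
Definition is_path u v (p : seq G) : bool :=
  [&& path (@adj G) u p, last u p == v & uniq (u :: p)].

Definition has_path_of_length u v (k : nat) : bool :=
  [exists p : k.-tuple G, is_path u v p].

(* The default value #|G|, taken when u and v lie in different components,
   exceeds the length of every path. *)
Definition gdist u v : nat :=
  \big[minn/#|G|]_(k < #|G| | has_path_of_length u v k) k.

Definition same_component u v : bool := connect (@adj G) u v.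

Definition general_position (S : {set G}) : bool :=
  [forall u in S, forall v in S, forall w in S,
     [&& u != v, u != w, v != w, same_component u v & same_component u w]
     ==> (gdist u v != gdist u w + gdist w v)].

Definition gp : nat := \max_(S : {set G} | general_position S) #|S|.

Lemma gdist_le u v p : is_path u v p -> gdist u v <= size p.
Proof.
move=> pth; have /and3P[_ _ /card_uniqP cardp] := pth.
have lt_p : size p < #|G| by rewrite -[(size p).+1]cardp max_card.
have hasp : has_path_of_length u v (size p).
  by apply/existsP; exists (in_tuple p).
rewrite /gdist; have := mem_index_enum (Ordinal lt_p).
elim: (index_enum _) => // k r IHr; rewrite inE big_cons => /predU1P[<-|/IHr le].
  by rewrite hasp geq_minl.
by case: ifP => // _; rewrite geq_min le orbT.
Qed.

Lemma gdist_path u v :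
  same_component u v -> exists2 p, is_path u v p & size p = gdist u v.
Proof.
case/connectP=> q pq ->; case: (shortenP pq) => p pp up _.
set t := last u p.
have ptp : is_path u t p by rewrite /is_path pp eqxx up.
have : gdist u t < #|G|.
  apply: leq_ltn_trans (gdist_le ptp) _.
  by move/card_uniqP: up => /= <-; apply: max_card.
pose P d := d < #|G| -> exists2 r, is_path u t r & size r = d.
have: P (gdist u t).
  rewrite /gdist; apply: (big_ind P) => [|x y Hx Hy|k].
  - by rewrite /P ltnn.
  - by rewrite /minn; case: ifP.
  - case/existsP=> r pr _; exists (tval r) => //; exact: size_tuple.
by apply.
Qed.

End GeneralPosition.

Section Kneser.
Variable n : nat.

Definition kneser2_vertex : finType := {A : {set 'I_n} | #|A| == 2}.

Definition kneser2_adj : rel kneser2_vertex :=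
  fun A B => [disjoint val A & val B].

Lemma kneser2_adj_sym : symmetric kneser2_adj.
Proof. by move=> A B; rewrite /kneser2_adj disjoint_sym. Qed.

Lemma kneser2_adj_irrefl : irreflexive kneser2_adj.
Proof.
move=> [A cardA]; rewrite /kneser2_adj /= -setI_eq0 setIid.
by rewrite -cards_eq0 (eqP cardA).
Qed.

Definition kneser2 : sgraph := SGraph kneser2_adj_sym kneser2_adj_irrefl.

End Kneser.

(* Main.v *)
Require Import Defs.
From mathcomp Require Import all_boot.
From mathcomp Require Import zify.

Set Implicit Arguments.
Unset Strict Implicit.
Unset Printing Implicit Defensive.

(** A general position set S contains no induced path on three vertices, as its
    middle vertex would lie on a geodesic between the ends: adjacency is
    transitive on distinct vertices of S. Since the components of K(n,2) have
    diameter at most 2, this is also sufficient. Viewing the elements of S as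
    edges on [n], there are three cases. If they are pairwise disjoint, then
    |S| <= n/2. If they pairwise intersect, then S is contained in a star
    (|S| <= n-1) or in a triangle. If u, v in S are disjoint and another w in S
    meets u, then by transitivity every edge of S lies in the union of u and v, so
    |S| <= 6. Stars and complete graphs on 4 points attain the bounds. *)

(** * Distances one and two in an arbitrary graph *)

Section Distance.
Variable G : sgraph.
Implicit Types u v w : G.

Lemma same_component_sym u v : same_component u v = same_component v u.
Proof. exact/sym_connect_sym/adj_sym. Qed.

Lemma gdistxx u : gdist u u = 0.
Proof.
apply/eqP; rewrite -leqn0.
by apply: (@gdist_le _ u u [::]); rewrite /is_path /= eqxx.
Qed.

Lemma gdist_gt0 u v : same_component u v -> u != v -> 0 < gdist u v.
Proof.
by move=> /gdist_path[[|x p] /and3P[_ /eqP/= lastp _] <-] //; rewrite lastp eqxx.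
Qed.

Lemma gdist1_adj u v : same_component u v -> gdist u v = 1 -> adj u v.
Proof.
by move=> /gdist_path[[|x [|y p]] /and3P[/= + /eqP/= <- _] <-] //; rewrite andbT.
Qed.

Lemma adj_neq u v : adj u v -> u != v.
Proof. by apply: contraTneq => ->; rewrite adj_irrefl. Qed.

Lemma gdist_adj u v : adj u v -> gdist u v = 1.
Proof.
move=> uv; have neq := adj_neq uv.
apply/eqP; rewrite eqn_leq gdist_gt0 ?andbT; [|exact: connect1|by []].
by apply: (@gdist_le _ u v [:: v]); rewrite /is_path /= uv eqxx inE neq.
Qed.

Lemma gdist_le2 u v w : adj u w -> adj w v -> gdist u v <= 2.
Proof.
move=> uw wv; have uDw := adj_neq uw; have wDv := adj_neq wv.
have [<-|uDv] := eqVneq u v; first by rewrite gdistxx.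
apply: (@gdist_le _ u v [:: w; v]).
by rewrite /is_path /= uw wv eqxx !inE negb_or uDw uDv wDv.
Qed.

Lemma general_position_trans (S : {set G}) u v w :
    general_position S -> u \in S -> v \in S -> w \in S -> u != v ->
  adj u w -> adj w v -> adj u v.
Proof.
move=> gpS uS vS wS uDv uw wv.
have cuw : same_component u w by apply: connect1.
have cuv : same_component u v by apply: connect_trans cuw (connect1 wv).
move/forall_inP/(_ u uS)/forall_inP/(_ v vS)/forall_inP/(_ w wS)/implyP: gpS.
rewrite uDv cuv cuw (adj_neq uw) eq_sym (adj_neq wv) => /(_ isT).
rewrite (gdist_adj uw) (gdist_adj wv) => gdistD2.
apply: gdist1_adj => //; have := gdist_le2 uw wv.
by have := gdist_gt0 cuv uDv; lia.
Qed.

(** A geodesic of length at most 2 with an inner vertex [w] splits into two edges at [w]. The second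
    hypothesis forbids triangles as well as induced paths: no vertex of [S] has two neighbours in
    [S], which is the case in both extremal examples. *)
Lemma general_position_diam2 (S : {set G}) :
    (forall u v, same_component u v -> gdist u v <= 2) ->
    (forall u v w, u \in S -> v \in S -> w \in S -> u != v ->
       adj u w -> ~~ adj w v) ->
  general_position S.
Proof.
move=> diam2 S_P3free; apply/forall_inP=> u uS; apply/forall_inP=> v vS.
apply/forall_inP=> w wS; apply/implyP=> /and5P[uDv uDw vDw cuv cuw].
have cwv : same_component w v.
  by apply: connect_trans cuv; rewrite [connect _ _ _]same_component_sym.
have := diam2 _ _ cuv; have := gdist_gt0 cuw uDw.
have := gdist_gt0 cwv; rewrite eq_sym => /(_ vDw) wv_gt0 uw_gt0 uv_le2.
apply/eqP=> uvE.
have uw : adj u w by apply: gdist1_adj => //; lia.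
have /negP[] := S_P3free _ _ _ uS vS wS uDv uw.
by apply: gdist1_adj => //; lia.
Qed.

End Distance.

(** The points where [C] meets the disjoint sets [A] and [B] are different, so they exhaust [C]. *)
Lemma subset_card2 (T : finType) (A B C : {set T}) :
    #|C| = 2 -> [disjoint A & B] -> ~~ [disjoint C & A] ->
  ~~ [disjoint C & B] -> C \subset A :|: B.
Proof.
move=> C2 dAB; rewrite -!setI_eq0 => /set0Pn[x /setIP[xC xA]].
case/set0Pn=> y /setIP[yC yB].
have xDy : x != y by apply: contraTneq yB => <-; rewrite (disjointFr dAB).
have -> : C = [set x; y].
  apply/eqP; rewrite eq_sym eqEcard cards2 xDy C2 leqnn andbT.
  by apply/subsetP=> z /set2P[]->.
by apply/subsetP=> z /set2P[]->; rewrite !inE ?xA ?yB ?orbT.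
Qed.

Section Kneser.
Variable n : nat.
Implicit Types (u v w x : kneser2 n) (S : {set kneser2 n}) (Q : {set 'I_n}).

Lemma card_vertex u : #|val u| = 2.
Proof. exact/eqP/(valP u). Qed.

Lemma adjE u v : adj u v = [disjoint val u & val v].
Proof. by []. Qed.

Definition complete Q : {set kneser2 n} :=
  [set x : kneser2 n | val x \subset Q].

Definition star (a : 'I_n) : {set kneser2 n} :=
  [set x : kneser2 n | a \in val x].

Lemma card_complete Q : #|complete Q| = 'C(#|Q|, 2).
Proof.
rewrite -cards_draws -(card_imset (mem (complete Q)) val_inj).
congr #|pred_of_set _|.
apply/setP=> A; rewrite [RHS]inE; apply/imsetP/andP=> [[x + ->]|[AQ A2]].
  by rewrite inE => ->; rewrite card_vertex.
by exists (Sub A A2 : kneser2_vertex n); rewrite // inE.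
Qed.

Lemma card_star a : #|star a| = n.-1.
Proof.
have := cardsID (star a) (complete setT).
have -> : complete setT :\: star a = complete [set~ a].
  by apply/setP=> x; rewrite !inE subsetT subsetC sub1set inE andbT.
have -> : complete setT :&: star a = star a.
  by apply/setP=> x; rewrite !inE subsetT.
rewrite !card_complete cardsC1 cardsT card_ord.
have n_gt0 : 0 < n by apply: leq_ltn_trans (ltn_ord a).
(* Pascal's rule: the pairs avoiding [a] number ['C(n.-1, 2)]. *)
have : 'C(n, 2) = 'C(n.-1, 2) + n.-1.
  by rewrite -[in LHS](prednK n_gt0) binS bin1.
lia.
Qed.

(** * Upper bound: disjoint, intersecting and mixed families of pairs *)

Lemma pairwise_adj_card S :
  {in S &, forall u v, u != v -> adj u v} -> #|S| <= n %/ 2.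
Proof.
move=> adjS; rewrite leq_divRL // -[X in _ <= X]card_ord.
have triv : trivIset (val @: S).
  apply/trivIsetP=> _ _ /imsetP[u uS ->] /imsetP[v vS ->] uDv.
  by apply: adjS => //; apply: contraNneq uDv => ->.
have := max_card (mem (cover (val @: S))).
rewrite -(eqP triv) big_imset => [|u v _ _ /val_inj //].
by under eq_bigr do rewrite card_vertex; rewrite sum_nat_const.
Qed.

(** Let two members [u], [v] meet in [a]. A member [w] avoiding [a] must join the other point of [u]
    to that of [v]; then every member lies in the three points of the union of [u] and [v]. *)
Lemma pairwise_nonadj_card S :
  {in S &, forall u v, ~~ adj u v} -> #|S| <= maxn 6 n.-1.
Proof.
move=> nadjS; have [|/card_gt1P[u [v [uS vS uDv]]]] := leqP #|S| 1; first lia.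
have /set0Pn[a /setIP[au av]] : val u :&: val v != set0.
  by rewrite setI_eq0; apply: nadjS.
have [Sa|/subsetPn[w wS]] := boolP (S \subset star a).
  by apply: leq_trans (subset_leq_card Sa) _; rewrite card_star leq_maxr.
rewrite inE => aNw.
have /eqP uv1 : #|val u :&: val v| == 1.
  rewrite eqn_leq card_gt0 andbC; apply/andP; split.
    by apply/set0Pn; exists a; rewrite inE au.
  rewrite leqNgt; apply: contra uDv => uv2; apply/eqP/val_inj/eqP.
  have /eqP/setIidPl uv : val u :&: val v == val u.
    by rewrite eqEcard subsetIl card_vertex.
  by rewrite eqEcard !card_vertex leqnn andbT.
have uvE : val u :&: val v = [set a].
  by apply/eqP; rewrite eq_sym eqEcard uv1 cards1 sub1set inE au av.
have duv : [disjoint val u :\ a & val v :\ a].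
  by rewrite -setI_eq0 -setDIl uvE setDv.
have meetD (x y : kneser2 n) : x \in S -> y \in S -> a \notin val x ->
    ~~ [disjoint val x & val y :\ a].
  move=> xS yS aNx; have := nadjS _ _ xS yS.
  rewrite adjE -!setI_eq0 => /set0Pn[z /setIP[zx zy]].
  apply/set0Pn; exists z; rewrite !inE zx zy !andbT.
  by apply: contraNneq aNx => <-.
have subN x : x \in S -> a \notin val x -> val x \subset val u :|: val v.
  move=> xS aNx; apply: subset_trans (setUSS (subD1set _ a) (subD1set _ a)).
  by apply: subset_card2; rewrite ?card_vertex ?meetD.
have sub : S \subset complete (val u :|: val v).
  apply/subsetP=> x xS; rewrite inE.
  have [ax|/(subN _ xS)//] := boolP (a \in val x).
  (* A member through [a] also meets [w], which avoids [a]. *)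
  apply: subset_trans (_ : [set a] :|: val w \subset _); last first.
    by rewrite subUset subN // sub1set inE au.
  apply: subset_card2; rewrite ?card_vertex //.
  - by rewrite disjoints1.
  - by rewrite disjoint_sym disjoints1 ax.
  - exact: nadjS.
(* The union has 2 + 2 - 1 = 3 points, hence carries 3 pairs. *)
apply: leq_trans (subset_leq_card sub) _.
by rewrite card_complete cardsU !card_vertex uv1 leq_max.
Qed.

Lemma mixed_card S u v w :
    general_position S -> u \in S -> v \in S -> w \in S ->
    adj u v -> w != u -> ~~ adj w u ->
  #|S| <= 6.
Proof.
move=> gpS uS vS wS uv wDu wNu.
have vu : adj v u by rewrite adj_sym.
have wDv : w != v by apply: contraNneq wNu => ->.
have wNv : ~~ adj w v.
  by apply: contra wNu => wv; apply: (general_position_trans gpS _ _ _ _ wv vu).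
have wQ : val w \subset val u :|: val v by apply: subset_card2; rewrite ?card_vertex.
have sub : S \subset complete (val u :|: val v).
  apply/subsetP=> x xS; rewrite inE.
  have [->|xDu] := eqVneq x u; first exact: subsetUl.
  have [->|xDv] := eqVneq x v; first exact: subsetUr.
  have [xu|xNu] := boolP (adj x u); last first.
    apply: subset_card2; rewrite ?card_vertex //.
    by apply: contra xNu => xv; apply: (general_position_trans gpS _ _ _ _ xv vu).
  (* Here [x] is disjoint from [u] and [v], hence from [w]; transitivity through [x] would make [w]
     adjacent to [u]. *)
  have xv : adj x v by apply: (general_position_trans gpS _ _ _ _ xu uv).
  have wx : adj w x.
    rewrite adj_sym adjE; apply: disjointWr wQ _.
    by rewrite -setI_eq0 setIUr setU_eq0 !setI_eq0; apply/andP.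
  by case/negP: wNu; apply: (general_position_trans gpS _ _ _ _ wx xu).
apply: leq_trans (subset_leq_card sub) _.
by rewrite card_complete cardsU !card_vertex (disjoint_setI0 uv) cards0.
Qed.

Lemma general_position_card S : general_position S -> #|S| <= maxn 6 n.-1.
Proof.
move=> gpS.
have [/forall_inP nadjS|] :=
  boolP [forall u in S, [forall v in S, ~~ adj u v]].
  by apply: pairwise_nonadj_card => u v uS; move: v; apply/forall_inP/nadjS.
case/forall_inPn=> u uS /forall_inPn[v vS /negbNE uv].
have [/forall_inP adjS|] :=
  boolP [forall w in S, (w != u) ==> adj w u]; last first.
  case/forall_inPn=> w wS; rewrite negb_imply => /andP[wDu wNu].
  by rewrite leq_max (mixed_card gpS uS vS wS uv).
(* All other members are adjacent to [u], so transitivity through [u] applies. *)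
have /pairwise_adj_card : {in S &, forall x y, x != y -> adj x y}.
  move=> x y xS yS xDy.
  have [xu|xDu] := eqVneq x u.
    by rewrite adj_sym xu (implyP (adjS y yS)) // -xu eq_sym.
  have [->|yDu] := eqVneq y u; first exact: (implyP (adjS x xS)).
  apply: (general_position_trans gpS xS yS uS xDy).
    exact: (implyP (adjS x xS)).
  by rewrite adj_sym (implyP (adjS y yS)).
lia.
Qed.

(** * Lower bound: diameter and extremal sets *)

Lemma kneser2_diam2 u v : 4 <= n -> same_component u v -> gdist u v <= 2.
Proof.
move=> n_ge4 cuv.
have [->|uDv] := eqVneq u v; first by rewrite gdistxx.
have [uv|] := boolP (adj u v); first by rewrite gdist_adj.
rewrite adjE -setI_eq0 -card_gt0 => uv_meet.
have := cardsC (val u :|: val v).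
have := cardsU (val u) (val v); rewrite !card_vertex card_ord => uvU uvC.
(* Two points outside both [u] and [v] form a common neighbour. *)
have [|] := leqP 2 #|~: (val u :|: val v)|.
  case/card_gt1P=> i [j [iQ jQ iDj]].
  have ij2 : #|[set i; j]| == 2 by rewrite cards2 iDj.
  have ijQ : [disjoint [set i; j] & val u :|: val v].
    rewrite disjoints_subset; apply/subsetP=> k /set2P[]-> //.
  have uw : adj u (Sub [set i; j] ij2 : kneser2_vertex n).
    by rewrite adj_sym adjE /=; apply: disjointWr ijQ; apply: subsetUl.
  apply: gdist_le2 uw _.
  by rewrite adjE /=; apply: disjointWr ijQ; apply: subsetUr.
(* Otherwise n = 4, and adjacency is complementation. *)
move=> Q_small; have n4 : n = 4 by lia.
have adjC x y : adj x y -> val y = ~: val x.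
  rewrite adjE disjoint_sym disjoints_subset => yx.
  apply/eqP; rewrite eqEcard yx card_vertex.
  by have := cardsC (val x); rewrite card_vertex card_ord; lia.
(* A component is then a single edge, so [v], being different from [u], would be its complement and
   could not meet it. *)
have compl x p : path (@adj _) x p ->
    val (last x p) = val x \/ val (last x p) = ~: val x.
  elim: p x => [|y p IHp] x /=; first by left.
  by case/andP=> /adjC xy /IHp; rewrite xy setCK => -[]; [right|left].
case/connectP: cuv => p /compl + vE; rewrite -vE => -[/val_inj vu|vC].
  by rewrite vu eqxx in uDv.
by move: uv_meet; rewrite vC setICr cards0.
Qed.

(** Inside four points, the only pair disjoint from [w] is its complement in [Q], so the induced
    graph is a matching. *)
Lemma complete4_general_position Q :
  4 <= n -> #|Q| = 4 -> general_position (complete Q).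
Proof.
move=> n_ge4 Q4; apply: general_position_diam2 => [u v|u v w].
  exact: kneser2_diam2.
rewrite !inE => uQ vQ wQ uDv uw; apply: contra uDv => wv; apply/eqP/val_inj.
have complQ x : val x \subset Q -> [disjoint val x & val w] ->
    val x = Q :\: val w.
  move=> xQ xw; apply/eqP; rewrite eqEcard subsetD xQ xw /=.
  by rewrite cardsD (setIidPr wQ) Q4 !card_vertex.
by rewrite (complQ u) // (complQ v) // disjoint_sym.
Qed.

Lemma star_general_position a : 4 <= n -> general_position (star a).
Proof.
move=> n_ge4; apply: general_position_diam2 => [u v|u v w].
  exact: kneser2_diam2.
rewrite !inE => au _ aw _; rewrite adjE => /disjointFr/(_ au).
by rewrite aw.
Qed.

End Kneser.

Theorem theorem2p2 (n : nat) (hn : 4 <= n) :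
  gp (kneser2 n) = if n <= 6 then 6 else n - 1.
Proof.
(* The two values agree at n = 7, where the star catches up with the complete graph on four
   points. *)
have -> : (if n <= 6 then 6 else n - 1) = maxn 6 n.-1 by case: ifP; lia.
apply/eqP; rewrite eqn_leq; apply/andP; split.
  by apply/bigmax_leqP=> S; apply: general_position_card.
rewrite geq_max; apply/andP; split.
  have [Q Q4] : exists Q : {set 'I_n}, #|Q| = 4.
    have : 0 < #|[set Q : {set 'I_n} | #|Q| == 4]|.
      by rewrite card_draws card_ord bin_gt0.
    by case/card_gt0P=> Q; rewrite inE => /eqP; exists Q.
  rewrite -[6]/('C(4, 2)) -Q4 -card_complete.
  exact/leq_bigmax_cond/complete4_general_position.
have n_gt0 : 0 < n by lia.
rewrite -(card_star (Ordinal n_gt0)).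
exact/leq_bigmax_cond/star_general_position.
Qed.
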